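(* There exist universal constants $C, c > 0$ and $\lambda_0 \in (0,1]$ such that the following holds. Let $d, n$ be positive integers with $n \ge C d$, and let $v_1, \dots, v_n$ be independent uniformly random unit vectors in $S^{d-1} \subseteq \mathbb{R}^d$. Then with probability at least $1 - \exp(-c n)$, the matrix $V = (v_1, \dots, v_n) \in \mathbb{R}^{d \times n}$ satisfies $(1-\lambda)$-$\infty$-expansion for some $\lambda \ge \lambda_0$.
   Context: For $V = (v_1, \dots, v_n) \in \mathbb{R}^{d\times n}$, the size is $s(V) := \|V\|_F^2$. $V$ satisfies $(1-\lambda)$-$\infty$-expansion if for all $y \in \mathbb{R}^n$ with $\sum_j y_j = 0$ and $\|y\|_\infty \le 1$, \[ \Big\| \sum_{j=1}^n y_j v_j v_j^T \Big\|_{\mathrm{op}} \le \frac{s(V)(1-\lambda)}{d} , \] where $\|\cdot\|_{\mathrm{op}}$ is the operator norm. *)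

(* Defs.v *)
From HB Require Import structures.
From mathcomp Require Export all_boot all_order all_algebra.
From mathcomp Require Export all_classical all_reals all_analysis.

Set Implicit Arguments.
Unset Strict Implicit.
Unset Printing Implicit Defensive.

Export Order.TTheory GRing.Theory Num.Theory.
Export numFieldNormedType.Exports.

Local Open Scope classical_set_scope.
Local Open Scope ring_scope.

Definition enorm (R : realType) (d : nat) (x : 'cV[R]_d) : R :=
  Num.sqrt (\sum_i x i ord0 ^+ 2).

Definition opnorm (R : realType) (m d : nat) (A : 'M[R]_(m, d)) : R :=
  sup [set enorm (A *m x) | x in [set x : 'cV[R]_d | enorm x <= 1]].

Definition frobenius (R : realType) (d n : nat) (V : 'M[R]_(d, n)) : R :=
  Num.sqrt (\sum_i \sum_j V i j ^+ 2).

Definition frame_size (R : realType) (d n : nat) (V : 'M[R]_(d, n)) : R :=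
  frobenius V ^+ 2.

(* [`|y|] on matrices is the maximum of the absolute values of the entries.
   The parameter is [lam], not [1 - lam]. *)
Definition inf_expansion (R : realType) (d n : nat) (lam : R)
    (V : 'M[R]_(d, n)) : Prop :=
  forall y : 'cV[R]_n, \sum_j y j ord0 = 0 -> `|y| <= 1 ->
    opnorm (\sum_j y j ord0 *: (col j V *m (col j V)^T))
      <= frame_size V * (1 - lam) / d%:R.

(* R^d with its Borel sigma-algebra *)
Definition borel_cV (R : realType) (d : nat) :=
  g_sigma_algebraType [set A : set 'cV[R]_d | open A].

(* The uniform probability measure on the unit sphere S^(d-1), viewed as a
   Borel measure on R^d, is the unique probability measure that is carried by
   the sphere and invariant under the orthogonal group O(d). *)
Definition uniform_on_sphere (R : realType) (d : nat)
    (mu : probability (borel_cV R d) R) : Prop :=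
  mu [set x : 'cV[R]_d | enorm x = 1] = 1%E /\
  forall U : 'M[R]_d, U^T *m U = 1%:M ->
    forall A : set (borel_cV R d), measurable A ->
      mu [set x : 'cV[R]_d | A (U *m x)] = mu A.

Definition mutually_independent (R : realType) (dO dT : measure_display)
    (Omega : measurableType dO) (P : probability Omega R)
    (T : measurableType dT) (I : finType) (X : I -> {RV P >-> T}) : Prop :=
  forall (J : {set I}) (B : I -> set T),
    (forall i, i \in J -> measurable (B i)) ->
    P [set w | forall i, i \in J -> B i (X i w)] =
      (\prod_(i in J) P (X i @^-1` B i))%E.

Definition matrix_of_columns (R : realType) (d n : nat)
    (v : 'I_n -> 'cV[R]_d) : 'M[R]_(d, n) := \matrix_(i, j) v j i ord0.

(* Main.v *)
Require Import Defs.
From mathcomp Require Import measurable_realfun ring lra.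

Set Implicit Arguments.
Unset Strict Implicit.
Unset Printing Implicit Defensive.

Local Open Scope classical_set_scope.
Local Open Scope ring_scope.

(* For a unit vector x put A_j = d <v_j, x>^2. If y sums to zero and
   |y_j| <= 1, then for any constant t
     |x^T (sum_j y_j v_j v_j^T) x| <= (1/d) sum_j |A_j - t|,
   so it suffices to bound the right-hand side, with t = 1/2, for all x in a
   net. Rotation invariance determines the moments of A_j, via a recursion
   obtained by expanding the radial function z |-> E <v, z>^(2k). From
   |A - 1/2| <= A - 1/2 + g(A)^2, with g a cubic such that g(0) = 1, six moments
   give E |A_j - 1/2| <= 67/70 < 1 in every dimension, and the moment bounds
   E A_j^k <= 2^k k! give a Chernoff bound for the sum. The net consists of
   C^d points of a rescaled integer lattice, whose number is beaten by the
   Chernoff bound as soon as n >= C' d. *)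

(** * Euclidean geometry and quadratic forms *)

(** With t = 0 the right-hand side is the average of the A_j, which concentrates at 1 and gives no
    expansion at all; the whole gain is a t with E |A - t| below 1 uniformly in d. The value 1/2
    lies near the median (about 0.455) of a squared Gaussian, the limit law of A. Since |A - 1/2|
    exceeds A - 1/2 only where A < 1/2, and there by 1 - 2A, it suffices that g^2 dominates 1 - 2A
    there and that E g(A)^2 < 1/2.

    The degree of g is forced by the Gaussian limit: under g(0) = 1 the least value of E g(A)^2 is
    the reciprocal of 1 + 1/2 + 3/8 + 5/16 + ..., one term per coefficient of g (the Christoffel
    function at 0). Degree 2 gives 8/15, too large; degree 3 gives 16/35. Hence a cubic and six
    moments.

    The constants then degrade in two stages: 67/70 for the mean becomes 69/70 with high probability
    on the net, and 138/139 on the whole ball. *)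

Definition dot (R : realType) (d : nat) (x z : 'cV[R]_d) : R :=
  \sum_i x i ord0 * z i ord0.

Section Dot.
Variables (R : realType) (d : nat).
Implicit Types (x y z : 'cV[R]_d) (a : R).

Lemma dotC x z : dot x z = dot z x.
Proof. by apply: eq_bigr => i _; rewrite mulrC. Qed.

Lemma dotDl x y z : dot (x + y) z = dot x z + dot y z.
Proof. by rewrite -big_split; apply: eq_bigr => i _; rewrite mxE mulrDl. Qed.

Lemma dotZl a x z : dot (a *: x) z = a * dot x z.
Proof. by rewrite mulr_sumr; apply: eq_bigr => i _; rewrite mxE mulrA. Qed.

Lemma dotDr x y z : dot z (x + y) = dot z x + dot z y.
Proof. by rewrite !(dotC z) dotDl. Qed.

Lemma dotZr a x z : dot z (a *: x) = a * dot z x.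
Proof. by rewrite !(dotC z) dotZl. Qed.

Lemma dotBl x y z : dot (x - y) z = dot x z - dot y z.
Proof. by rewrite -scaleN1r dotDl dotZl mulN1r. Qed.

Lemma dotBr x y z : dot z (x - y) = dot z x - dot z y.
Proof. by rewrite !(dotC z) dotBl. Qed.

Lemma dot_ge0 x : 0 <= dot x x.
Proof. by apply: sumr_ge0 => i _; rewrite -expr2 sqr_ge0. Qed.

Lemma dot_eq0 x : (dot x x == 0) = (x == 0).
Proof.
rewrite psumr_eq0; last by move=> i _; rewrite -expr2 sqr_ge0.
apply/idP/eqP => [/allP h|->]; last first.
  by apply/allP => i _; rewrite mxE mul0r eqxx.
apply/matrixP => i j; rewrite ord1 mxE; apply/eqP.
by have := h i (mem_index_enum _); rewrite -expr2 expf_eq0.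
Qed.

Lemma mulmx_tr_dot x z : (x^T *m z) ord0 ord0 = dot x z.
Proof. by rewrite mxE; apply: eq_bigr => i _; rewrite mxE. Qed.

Lemma dot_mulmx (U : 'M[R]_d) x z : dot (U *m x) z = dot x (U^T *m z).
Proof. by rewrite -!mulmx_tr_dot trmx_mul mulmxA. Qed.

Lemma enormE x : enorm x = Num.sqrt (dot x x).
Proof. by congr Num.sqrt; apply: eq_bigr => i _; rewrite expr2. Qed.

Lemma enorm_ge0 x : 0 <= enorm x.
Proof. exact: sqrtr_ge0. Qed.

Lemma enorm_sqr x : enorm x ^+ 2 = dot x x.
Proof. by rewrite enormE sqr_sqrtr // dot_ge0. Qed.

Lemma enorm_eq0 x : (enorm x == 0) = (x == 0).
Proof. by rewrite -dot_eq0 -enorm_sqr sqrf_eq0. Qed.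

Lemma enorm_eq1 x : (enorm x = 1) <-> (dot x x = 1).
Proof.
split=> h; first by rewrite -enorm_sqr h expr1n.
by rewrite enormE h sqrtr1.
Qed.

Lemma dot_unit x : x != 0 ->
  dot ((enorm x)^-1 *: x) ((enorm x)^-1 *: x) = 1.
Proof.
rewrite -enorm_eq0 => x0.
by rewrite dotZl dotZr -enorm_sqr expr2 mulrA -invfM mulVf // mulf_neq0.
Qed.

Lemma CauchySchwarz_dot x z : dot x z ^+ 2 <= dot x x * dot z z.
Proof.
have [->|z0] := eqVneq z 0.
  have d0 y : dot y 0 = 0 :> R by rewrite -(scale0r 0) dotZr mul0r.
  by rewrite !d0 expr0n mulr0.
have zz : 0 < dot z z by rewrite lt_def dot_eq0 z0 dot_ge0.
have := dot_ge0 (x - (dot x z / dot z z) *: z).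
rewrite dotBl !dotBr !dotZl !dotZr (dotC z x) => h.
rewrite -ler_pdivrMr //.
suff E : dot x z ^+ 2 / dot z z = dot x x -
   (dot x x - dot x z / dot z z * dot x z -
       (dot x z / dot z z * (dot x z - dot x z / dot z z * dot z z))).
  by rewrite E; lra.
by field; rewrite gt_eqF.
Qed.

(* Householder reflection along [z - z']. *)
Lemma orthogonal_transitive z z' : dot z z = dot z' z' ->
  exists2 U : 'M[R]_d, U^T *m U = 1%:M & U^T *m z = z'.
Proof.
move=> zz'; have [<-|nzz] := eqVneq z z'.
  by exists 1%:M; rewrite trmx1 ?mul1mx // mul1mx.
pose w := z - z'; pose c := 2 / dot w w.
have w0 : dot w w != 0 by rewrite dot_eq0 subr_eq0.
have ww : w^T *m w = (dot w w)%:M.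
  by apply/matrixP => i j; rewrite !ord1 mulmx_tr_dot mxE eqxx.
pose U : 'M[R]_d := 1%:M - c *: (w *m w^T).
have UT : U^T = U by rewrite /U linearB /= linearZ /= trmx_mul trmxK trmx1.
exists U; rewrite UT.
  have WW : w *m w^T *m (w *m w^T) = dot w w *: (w *m w^T).
    by rewrite -mulmxA (mulmxA w^T) ww mul_scalar_mx -scalemxAr.
  rewrite /U mulmxBl mul1mx mulmxBr mulmx1 -scalemxAl -scalemxAr WW !scalerA.
  have -> : c * c * dot w w = c + c by rewrite /c; field.
  by rewrite scalerDl opprB addrK subrK.
rewrite /U mulmxBl mul1mx -scalemxAl -mulmxA.
have -> : w^T *m z = (dot w z)%:M.
  by apply/matrixP => i j; rewrite !ord1 mulmx_tr_dot mxE eqxx.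
rewrite mul_mx_scalar scalerA.
suff -> : c * dot w z = 1 by rewrite scale1r /w opprB addrC subrK.
have E : dot w w = 2 * dot w z.
  by rewrite /w dotBl !dotBr !dotBl -zz' (dotC z z'); ring.
by rewrite /c E invfM mulrA divff ?pnatr_eq0 // mul1r mulVf //;
  apply: contra w0 => /eqP h; rewrite E h mulr0.
Qed.

End Dot.

(** Duality: the norm of [A *m x] is reached by pairing it with its own direction. A supremum of
    square roots becomes a family of bilinear conditions, which serves both the upper bound on the
    norm and the closedness of the expansion event. *)
Lemma opnorm_leP (R : realType) (d : nat) (A : 'M[R]_d) (Q : R) :
  opnorm A <= Q <->
  (forall x z, dot x x <= 1 -> dot z z <= 1 -> dot (A *m x) z <= Q).
Proof.
have en1 (x : 'cV[R]_d) : (enorm x <= 1) = (dot x x <= 1).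
  by rewrite -enorm_sqr expr_le1 ?enorm_ge0.
have dot0 : dot 0 0 = 0 :> R by move=> d'; rewrite -(scale0r 0) dotZl mul0r.
split=> [AQ x z x1 z1|h].
  have CS : dot (A *m x) z <= enorm (A *m x).
    apply: (le_trans (ler_norm _)).
    rewrite -ler_sqr ?nnegrE ?enorm_ge0 // real_normK ?num_real //.
    apply: (le_trans (CauchySchwarz_dot _ _)).
    by rewrite enorm_sqr; apply: ler_piMr; rewrite ?dot_ge0.
  apply: (le_trans CS); apply: le_trans AQ; apply: ub_le_sup; last first.
    by exists x => //=; rewrite en1.
  (* The supremum dominates its members only once the set is known to be bounded; the rows of [A]
     provide a bound. *)
  pose r i : 'cV[R]_d := (row i A)^T.
  exists (Num.sqrt (\sum_i dot (r i) (r i))) => _ [y /= + <-]; rewrite en1 =>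
    y1.
  rewrite enormE ler_wsqrtr //; apply: ler_sum => i _.
  have -> : (A *m y) i ord0 = dot (r i) y.
    by rewrite mxE; apply: eq_bigr => j _; rewrite !mxE.
  rewrite -expr2; apply: (le_trans (CauchySchwarz_dot _ _)).
  by apply: ler_piMr; rewrite ?dot_ge0.
have Q0 : 0 <= Q.
  by have := h 0 0; rewrite mulmx0 dot0 ler01 => /(_ isT isT).
apply: ge_sup.
  by exists (enorm (A *m 0)), 0 => //=; rewrite enormE dot0 sqrtr0.
move=> _ [x /= + <-]; rewrite en1 => x1; set g := _ *m x.
have [->|g0] := eqVneq g 0; first by rewrite enormE dot0 sqrtr0.
have -> : enorm g = dot g ((enorm g)^-1 *: g).
  by rewrite dotZr -enorm_sqr expr2 mulrA mulVf ?mul1r // enorm_eq0.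
by apply: h => //; rewrite dot_unit.
Qed.

Section Expansion.
Variables (R : realType) (d n : nat) (v : 'I_n -> 'cV[R]_d) (y : 'cV[R]_n).

Definition weighted_form (x z : 'cV[R]_d) : R :=
  \sum_j y j ord0 * (dot (v j) x * dot (v j) z).

Let b := weighted_form.

Lemma weighted_formE x z :
  dot ((\sum_j y j ord0 *: (v j *m (v j)^T)) *m x) z = b x z.
Proof.
rewrite mulmx_suml.
have -> : dot (\sum_j (y j ord0 *: (v j *m (v j)^T)) *m x) z =
   \sum_j dot ((y j ord0 *: (v j *m (v j)^T)) *m x) z.
  elim/big_rec2: _ => [|j u w _ <-]; last by rewrite dotDl.
  by rewrite /dot big1 // => i _; rewrite mxE mul0r.
apply: eq_bigr => j _; rewrite -scalemxAl dotZl; congr (_ * _).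
rewrite dot_mulmx trmx_mul trmxK -mulmxA.
have -> : (v j)^T *m z = (dot (v j) z)%:M.
  by apply/matrixP => i k; rewrite !ord1 mulmx_tr_dot mxE eqxx.
by rewrite mul_mx_scalar dotZr mulrC dotC.
Qed.

Let q x := b x x.

Lemma weighted_formC x z : b x z = b z x.
Proof. by apply: eq_bigr => j _; rewrite (mulrC (dot _ _)). Qed.

Lemma weighted_formZl a x z : b (a *: x) z = a * b x z.
Proof. by rewrite mulr_sumr; apply: eq_bigr => j _; rewrite dotZr; ring. Qed.

Lemma weighted_formZr a x z : b x (a *: z) = a * b x z.
Proof. by rewrite weighted_formC weighted_formZl weighted_formC. Qed.

Lemma weighted_form_polarization x z : b x z = (q (x + z) - q (x - z)) / 4.
Proof.
rewrite /q /b /weighted_form -sumrB mulr_suml; apply: eq_bigr => j _.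
by rewrite !dotBr !dotDr; field.
Qed.

Lemma weighted_form_diff x z : q x - q z = b (x - z) (x + z).
Proof.
rewrite /q /b /weighted_form -sumrB; apply: eq_bigr => j _.
by rewrite !dotBr !dotDr; ring.
Qed.

(** Homogeneity extends the hypothesis to all vectors; polarization followed by the parallelogram
    law then gives the bound. *)
Lemma weighted_form_bilinear_bound Q :
  (forall x, dot x x <= 1 -> `|q x| <= Q) ->
  forall x z, `|b x z| <= Q * (dot x x + dot z z) / 2.
Proof.
move=> hQ.
have hq x : `|q x| <= Q * dot x x.
  have [->|x0] := eqVneq x 0.
    rewrite -(scale0r 0) /q weighted_formZl mul0r normr0 dotZl mul0r mulr0 //.
  have := hQ ((enorm x)^-1 *: x); rewrite dot_unit // => /(_ (lexx _)).
  rewrite /q weighted_formZl weighted_formZr -enorm_sqr mulrA -invfM -expr2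
    normrM.
  rewrite ger0_norm ?invr_ge0 ?sqr_ge0 // mulrC ler_pdivrMr //.
  by rewrite exprn_gt0 // lt_def enorm_eq0 x0 enorm_ge0.
move=> x z; rewrite weighted_form_polarization normrM.
rewrite (@ger0_norm _ (4^-1)) ?invr_ge0 ?ler0n //.
have := ler_normB (q (x + z)) (q (x - z)).
have := hq (x + z); have := hq (x - z).
rewrite !(dotBl, dotBr) !(dotDl, dotDr) (dotC z x); lra.
Qed.

(** Let Q be the supremum of [|q|] on the ball. In q x - q z = b (x - z) (x + z) the first argument
    is rescaled by 1/eps, so the squared lengths are at most 1 and 4 and the difference is at most
    5/2 eps Q. Thus Q <= a + 5/2 eps Q, which can be solved because Q is finite. *)
Lemma weighted_form_net_bound (N : set 'cV[R]_d) (a eps : R) :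
  0 < eps -> eps < 1/5 ->
  (forall x, dot x x <= 1 -> exists2 z, N z &
     dot z z <= 1 /\ dot (x - z) (x - z) <= eps ^+ 2) ->
  (forall z, N z -> dot z z <= 1 -> `|q z| <= a) ->
  forall x, dot x x <= 1 -> `|q x| <= a / (1 - 5 / 2 * eps).
Proof.
move=> e0 e1 hN ha.
pose A := [set `|q x| | x in [set x | dot x x <= 1]].
have dot0 : dot 0 0 = 0 :> R.
  by move=> d'; rewrite -(scale0r 0) dotZl mul0r.
have A0 : A !=set0 by exists `|q 0|; exists 0 => //=; rewrite dot0.
have dvx x i : dot x x <= 1 -> `|dot (v i) x| <= 1 + dot (v i) (v i).
  move=> x1; rewrite -ler_sqr ?nnegrE ?addr_ge0 ?dot_ge0 // -normrX.
  rewrite ger0_norm ?sqr_ge0 //; have := CauchySchwarz_dot (v i) x.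
  have := dot_ge0 (v i); have := dot_ge0 x; nra.
have Aub : has_ubound A.
  exists (\sum_j `|y j ord0| * (1 + dot (v j) (v j)) ^+ 2) => _ [x /= x1 <-].
  apply: (le_trans (ler_norm_sum _ _ _)); apply: ler_sum => j _.
  rewrite normrM ler_wpM2l // -expr2 normrX ler_sqr ?nnegrE //.
    exact: dvx.
  by rewrite addr_ge0 ?dot_ge0.
pose Q := sup A.
have hQ x : dot x x <= 1 -> `|q x| <= Q.
  by move=> x1; apply: (ub_le_sup Aub); exists x.
have Q0 : 0 <= Q by apply: le_trans (hQ 0 _); rewrite ?normr_ge0 ?dot0.
suff : Q <= a + 5 / 2 * eps * Q.
  move=> h x x1; apply: (le_trans (hQ _ x1)); rewrite ler_pdivlMr; lra.
apply: (ge_sup A0) => _ [x /= x1 <-].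
have [z Nz [z1 xz]] := hN x x1.
have -> : q x = q z + eps * b (eps^-1 *: (x - z)) (x + z).
  by rewrite weighted_formZl mulrA divff ?gt_eqF // mul1r -weighted_form_diff
    addrC subrK.
apply: (le_trans (ler_normD _ _)); apply: lerD; first exact: ha.
rewrite normrM gtr0_norm // (_ : 5 / 2 * eps * Q = eps * (Q * (1 + 4) / 2));
  last by field.
rewrite ler_pM2l //; apply: (le_trans (weighted_form_bilinear_bound hQ _ _)).
rewrite ler_pM2r ?invr_gt0 ?ltr0n // ler_wpM2l // lerD //.
  rewrite dotZl dotZr mulrA -invfM -expr2 mulrC ler_pdivrMr ?mul1r //.
  by rewrite exprn_gt0.
have := dot_ge0 (x - z); rewrite !(dotBl, dotBr) !(dotDl, dotDr) (dotC z x);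
  lra.
Qed.

Lemma opnorm_le_form (Q : R) :
  (forall x, dot x x <= 1 -> `|q x| <= Q) ->
  opnorm (\sum_j y j ord0 *: (v j *m (v j)^T)) <= Q.
Proof.
move=> hQ; apply/opnorm_leP => x z x1 z1; rewrite weighted_formE.
apply: (le_trans (ler_norm _)); apply: (le_trans (weighted_form_bilinear_bound
  hQ _ _)).
have Q0 : 0 <= Q by apply: le_trans (hQ _ x1).
nra.
Qed.

End Expansion.

(** * A lattice net of the unit ball *)

Section Net.
Variables (R : realType) (d m M : nat).

(* Each coordinate is given by its sign and its absolute value. *)
Definition net_index := {ffun 'I_d -> bool * 'I_M.+1}.

Definition net_weight (k : net_index) : nat := \sum_i (k i).2.

Definition net_point (k : net_index) : 'cV[R]_d :=
  \col_i ((-1) ^+ (k i).1 * (k i).2%:R / (m%:R * Num.sqrt d%:R)).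

(** Generating-function count: each admissible index satisfies 1 <= 2^N 2^(-weight), and the sum of
    2^(-weight) over all indices factors into d coordinates, each worth two signs times a geometric
    sum below 2. The weight constraint is what keeps the count exponential in d. *)
Lemma card_net (N : nat) :
  \sum_(k : net_index | (net_weight k <= N)%N) 1 <= 2 ^+ N * 4 ^+ d :> R.
Proof.
apply: (@le_trans _ _ (\sum_(k : net_index) 2 ^+ N * \prod_i 2^-1 ^+ (k i).2)).
  rewrite [leLHS]big_mkcond; apply: ler_sum => k _; rewrite prodrXr.
  case: ifP => [kN|_]; last by rewrite mulr_ge0 ?exprn_ge0 ?invr_ge0 ?ler0n.
  rewrite exprVn ler_pdivlMr ?exprn_gt0 // mul1r ler_eXn2l ?ltr1n //.
rewrite -mulr_sumr ler_wpM2l ?exprn_ge0 //.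
have := @bigA_distr_bigA R 0 1 _ _ 'I_d (bool * 'I_M.+1)%type
  (fun _ b => 2^-1 ^+ b.2).
move=> /= <-; rewrite prodr_const card_ord lerXn2r ?nnegrE ?ler0n //.
  by apply: sumr_ge0 => b _; rewrite exprn_ge0 ?invr_ge0.
rewrite (_ : \sum_b _ = \sum_(c : bool) \sum_(i < M.+1) 2^-1 ^+ i); last first.
  by rewrite pair_big.
have h : \sum_(i < M.+1) 2^-1 ^+ i <= 2 :> R.
  have : (1 - 2^-1) * \sum_(i < M.+1) 2^-1 ^+ i = 1 - 2^-1 ^+ M.+1 :> R.
    by rewrite -[1 - 2^-1]opprB mulNr -subrX1 opprB.
  have : 0 <= 2^-1 ^+ M.+1 :> R by rewrite exprn_ge0 ?invr_ge0.
  lra.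
by rewrite sumr_const card_bool; lra.
Qed.

(** Coordinates are rounded towards zero to multiples of 1/(m sqrt d): the point stays in the ball,
    and d squared errors of at most 1/(m^2 d) add up to 1/m^2. *)
Lemma net_cover (x : 'cV[R]_d) : (0 < d)%N -> (0 < m)%N -> (m * d <= M)%N ->
  dot x x <= 1 -> exists2 k : net_index, (net_weight k <= m * d)%N &
    dot (net_point k) (net_point k) <= 1 /\
    dot (x - net_point k) (x - net_point k) <= m%:R^-1 ^+ 2.
Proof.
move=> d0 m0 mdM x1.
have sd0 : 0 < Num.sqrt d%:R :> R by rewrite sqrtr_gt0 ltr0n.
have sd2 : Num.sqrt d%:R * Num.sqrt d%:R = d%:R :> R.
  by rewrite -expr2 sqr_sqrtr.
pose T : R := m%:R * Num.sqrt d%:R.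
have T0 : 0 < T by rewrite mulr_gt0 ?ltr0n.
pose t i := Num.truncn (`|x i ord0| * T).
have ht i : (t i)%:R <= `|x i ord0| * T < (t i)%:R + 1.
  by rewrite natr1; apply: truncn_itv; rewrite mulr_ge0 // ltW.
(* Cauchy-Schwarz against the all-ones vector; multiplied by [T] it bounds the weight by m sqrt d
   sqrt d = m d. *)
have l1 : \sum_i `|x i ord0| <= Num.sqrt d%:R.
  pose a : 'cV[R]_d := \col_i `|x i ord0|.
  pose o : 'cV[R]_d := const_mx 1.
  have := CauchySchwarz_dot a o.
  have -> : dot a o = \sum_i `|x i ord0|.
    by apply: eq_bigr => i _; rewrite !mxE mulr1.
  have -> : dot a a = dot x x.
    by apply: eq_bigr => i _; rewrite !mxE -!expr2 real_normK ?num_real.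
  have -> : dot o o = d%:R.
    rewrite /dot (eq_bigr (fun=> 1)) ?sumr_const ?card_ord //.
    by move=> i _; rewrite !mxE mulr1.
  move=> h; rewrite -ler_sqr ?nnegrE ?sqrtr_ge0 ?sumr_ge0 //.
  rewrite sqr_sqrtr ?ler0n // (le_trans h) //.
  by rewrite ler_piMl ?ler0n.
have tsum : (\sum_i t i <= m * d)%N.
  rewrite -(ler_nat R) natr_sum natrM -sd2 mulrA -/T mulrC.
  apply: (@le_trans _ _ (\sum_i `|x i ord0| * T)).
    by apply: ler_sum => i _; case/andP: (ht i).
  by rewrite -mulr_suml ler_pM2r.
have tM i : (t i < M.+1)%N.
  rewrite ltnS (leq_trans _ mdM) // (leq_trans _ tsum) //.
  by rewrite (bigD1 i) //= leq_addr.
pose k : net_index := [ffun i => (x i ord0 < 0, inord (t i))].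
have kE i : net_point k i ord0 = (-1) ^+ (x i ord0 < 0)%R * ((t i)%:R / T).
  by rewrite !mxE ffunE /= inordK // mulrA.
have hx i : x i ord0 = (-1) ^+ (x i ord0 < 0)%R * `|x i ord0|.
  by apply: realEsign; rewrite num_real.
exists k.
  by rewrite /net_weight (eq_bigr t) // => i _; rewrite ffunE /= inordK.
have sgn (b : bool) : (-1) ^+ b * (-1) ^+ b = 1 :> R.
  by rewrite -expr2 sqrr_sign.
split.
  apply: le_trans x1; apply: ler_sum => i _; rewrite kE {3 4}(hx i).
  rewrite mulrACA sgn [in leRHS]mulrACA sgn !mul1r.
  have h : (t i)%:R / T <= `|x i ord0|.
    by rewrite ler_pdivrMr //; case/andP: (ht i).
  by rewrite ler_pM // divr_ge0 // ltW.
have -> : m%:R^-1 ^+ 2 = \sum_(i < d) T^-1 ^+ 2 :> R.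
  have T2 : T ^+ 2 = m%:R ^+ 2 * d%:R by rewrite exprMn [_ ^+ 2 in X in _ *
    X]expr2 sd2.
  rewrite sumr_const card_ord -mulr_natl !exprVn T2; field.
  by rewrite !pnatr_eq0 -!lt0n m0 d0.
apply: ler_sum => i _; 
have -> : (x - net_point k) i ord0 = x i ord0 - net_point k i ord0.
  by move: (net_point k) => z; rewrite !mxE.
rewrite kE.
rewrite {1 3}(hx i) -!mulrBr mulrACA sgn mul1r -expr2.
case/andP: (ht i) => h1 h2.
rewrite ler_sqr ?nnegrE ?invr_ge0 ?(ltW T0) //.
  by rewrite lerBlDr -[X in X + _]mul1r -mulrDl ler_pdivlMr // addrC ltW.
by rewrite subr_ge0 ler_pdivrMr.
Qed.

End Net.

(** * Integration over the sphere *)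

Section MeasurableCoordinates.
Context {R : realType} {dO : measure_display} {Omega : measurableType dO}.

Lemma measurable_preimage_lt (h : Omega -> R) (r : R) :
  measurable_fun setT h -> measurable [set w | h w < r].
Proof.
move=> mh; rewrite (_ : mkset _ = setT `&` h @^-1` `]-oo, r[%classic).
  by apply: mh => //; exact: measurable_itv.
by apply/seteqP; split=> [w /= hw|w [_]]; rewrite /= in_itv //=.
Qed.

(** An open set is the countable union of the boxes with rational centre and radius 1/(e+1) that it
    contains, and the preimage of a box is a finite intersection of coordinate events. *)
Lemma measurable_preimage_open m n (f : Omega -> 'M[R]_(m, n)) :
  (forall i j, measurable_fun setT (fun w => f w i j)) ->
  forall O : set 'M[R]_(m, n), open O -> measurable (f @^-1` O).
Proof.
move=> mf O oO.
pose box (q : 'M[rat]_(m, n)) (e : nat) : set 'M[R]_(m, n) :=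
  [set A | forall i j, `|A i j - ratr (q i j)| < e.+1%:R^-1].
pose F (p : 'M[rat]_(m, n) * nat) : set Omega :=
  [set w | box p.1 p.2 `<=` O /\ box p.1 p.2 (f w)].
have -> : f @^-1` O = \bigcup_p F p.
  apply/seteqP; split => [w /= Ow|w [p _]]; last first.
    by case=> h /h.
  have /nbhs_ballP[e /= e0 eO] : nbhs (f w) O by apply: open_nbhs_nbhs.
  (* The factor 2 accounts for the detour from [f w] through the centre of the box to another of its
     points. *)
  have [N hN] : exists N : nat, 2 * N.+1%:R^-1 < e.
    exists (Num.truncn (2 / e)); rewrite ltr_pdivrMr ?ltr0n //.
    by rewrite mulrC -ltr_pdivrMr //; exact: truncnS_gt.
  have N0 : 0 < N.+1%:R^-1 :> R by rewrite invr_gt0 ltr0n.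
  have /choice[q hq] : forall ij : 'I_m * 'I_n, exists q : rat,
      `|f w ij.1 ij.2 - ratr q| < N.+1%:R^-1.
    move=> ij; have : f w ij.1 ij.2 - N.+1%:R^-1 < f w ij.1 ij.2 + N.+1%:R^-1.
      by rewrite ltrBlDr -addrA ltrDl addr_gt0.
    move=> /rat_in_itvoo[q]; rewrite in_itv /= => /andP[q1 q2]; exists q.
    by rewrite ltr_distlC q1 q2.
  exists (\matrix_(i, j) q (i, j), N) => //; rewrite /F /=; split; last first.
    by move=> i j; rewrite mxE; exact: (hq (i, j)).
  move=> A hA; apply: eO; split=> // i j; have := hA i j; rewrite mxE => h1.
  rewrite -ball_normE /=; apply: (le_lt_trans (ler_distD (ratr (q (i,
    j))) _ _)).
  apply: lt_trans hN; rewrite mulr_natl mulr2n; apply: ltrD;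
    first exact: (hq (i, j)).
  by rewrite distrC.
apply: countable_bigcupT_measurable => // p.
have [pO|pO] := pselect (box p.1 p.2 `<=` O); last first.
  by rewrite (_ : F p = set0) //; apply/seteqP; split=> // w [].
rewrite (_ : F p = \bigcap_(ij in [set: 'I_m * 'I_n])
   [set w | `|f w ij.1 ij.2 - ratr (p.1 ij.1 ij.2)| < p.2.+1%:R^-1]);
     last first.
  apply/seteqP; split => [w [_ h] ij _|w h]; first exact: h.
  by split=> // i j; exact: (h (i, j)).
apply: fin_bigcap_measurable => // ij _.
apply: measurable_preimage_lt.
apply: measurableT_comp => //; apply: measurable_funB => //.
Qed.

End MeasurableCoordinates.

Section BorelVectors.
Context {R : realType} {d : nat}.
Let T := borel_cV R d.

Lemma measurable_coord i : measurable_fun setT (fun x : T =>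
  (x : 'cV[R]_d) i ord0).
Proof.
apply: (measurability _ (RGenOInfty.measurableE R)) => _ [_ [a ->] <-].
rewrite setTI; apply: sub_sigma_algebra.
apply: (@open_comp _ _ (fun x : 'cV[R]_d => x i ord0)) => [x _|].
  exact: coord_continuous.
exact: interval_open.
Qed.

Lemma measurable_fun_borel_cV (dO : measure_display) (Omega : measurableType dO)
    (f : Omega -> T) :
  (forall i, measurable_fun setT (fun w => (f w : 'cV[R]_d) i ord0)) ->
  measurable_fun setT f.
Proof.
move=> mf; apply: (@measurability _ _ _ T setT f [set A : set 'cV[R]_d |
  open A] erefl) => _ [B oB <-].
rewrite setTI; apply: (@measurable_preimage_open _ _ _ d 1 f) => // i j.
by rewrite ord1.
Qed.

Lemma measurable_dot (z : 'cV[R]_d) :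
  measurable_fun setT (fun x : T => dot (x : 'cV[R]_d) z).
Proof.
rewrite /dot; apply: measurable_sum => i.
by apply: measurable_funM => //; exact: measurable_coord.
Qed.

Lemma measurable_mulmx (U : 'M[R]_d) :
  measurable_fun setT (fun x : T => (U *m (x : 'cV[R]_d) : T)).
Proof.
apply: measurable_fun_borel_cV => i.
rewrite (_ : (fun _ => _) = fun x : T => \sum_j U i j * (x : 'cV[R]_d) j ord0).
  apply: measurable_sum => j.
  by apply: measurable_funM => //; exact: measurable_coord.
by apply/funext => x; rewrite mxE.
Qed.

Definition sphere : set T := [set x : 'cV[R]_d | enorm x = 1].

Lemma sphereP (x : 'cV[R]_d) : sphere x -> dot x x = 1.
Proof. by move/enorm_eq1. Qed.

Lemma measurable_sphere : measurable sphere.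
Proof.
rewrite (_ : sphere = (fun x : T => dot (x : 'cV[R]_d) x) @^-1` [set 1]).
  rewrite -[X in measurable X]setTI.
  have : measurable_fun setT (fun x : T => dot (x : 'cV[R]_d) x).
    by apply: measurable_sum => i; apply: measurable_funM;
      exact: measurable_coord.
  by apply => //; exact: measurable_set1.
by apply/seteqP; split=> x /= /enorm_eq1.
Qed.

End BorelVectors.

Section SphereIntegral.
Context {R : realType} {d : nat}.
Let T := borel_cV R d.
Variable mu : probability (borel_cV R d) R.
Hypothesis hmu : uniform_on_sphere mu.
Implicit Types f g : T -> R.

Let S := @sphere R d.
Let mS : measurable S := measurable_sphere.

(** The bound is asked only on the sphere, where the integral is taken, since polynomials in x are
    unbounded on the whole space. The class is stable under the operations below, so every integrand
    met later is integrable. *)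
Definition sphere_bounded f :=
  measurable_fun setT f /\ exists M, forall x, sphere x -> `|f x| <= M.

Definition sphere_mean f : R := \int[mu]_(x in S) f x.
Local Notation I := sphere_mean.

Lemma sphere_bounded_cst r : sphere_bounded (cst r).
Proof. by split=> //; exists `|r|. Qed.

Lemma sphere_bounded_comp f (g : R -> R) : continuous g -> sphere_bounded f ->
  sphere_bounded (g \o f).
Proof.
move=> cg [mf [M hM]]; split.
  by apply: measurableT_comp => //; exact: continuous_measurable_fun.
have cgS : {within `[-M, M], continuous g}.
  by apply: continuous_subspaceT.
have [M0|M0] := leP (- M) M; last first.
  by exists 0 => x /hM h; move: (normr_ge0 (f x)) => ?; exfalso; lra.
have [a _ ha] := EVT_max M0 cgS; have [b _ hb] := EVT_min M0 cgS.
exists (`|g a| + `|g b|) => x /hM fx.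
have fM : f x \in `[-M, M] by rewrite in_itv /= -ler_norml.
have := ha _ fM; have := hb _ fM => h1 h2 /=.
rewrite ler_norml; apply/andP; split.
  by have := ler_norm (- g b); rewrite normrN; have := normr_ge0 (g a); lra.
by have := ler_norm (g a); have := normr_ge0 (g b); lra.
Qed.

Lemma sphere_boundedD f g : sphere_bounded f -> sphere_bounded g ->
  sphere_bounded (fun x => f x + g x).
Proof.
move=> [mf [M hM]] [mg [N hN]]; split; first exact: measurable_funD.
exists (M + N) => x xS; apply: (le_trans (ler_normD _ _)).
by apply: lerD; [exact: hM|exact: hN].
Qed.

Lemma sphere_boundedM f g : sphere_bounded f -> sphere_bounded g ->
  sphere_bounded (fun x => f x * g x).
Proof.
move=> [mf [M hM]] [mg [N hN]]; split; first exact: measurable_funM.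
by exists (M * N) => x xS; rewrite normrM ler_pM // ?hM ?hN.
Qed.

Lemma sphere_boundedX f k : sphere_bounded f -> sphere_bounded (fun x =>
  f x ^+ k).
Proof.
move=> hf; elim: k => [|k ih]; first exact: (sphere_bounded_cst 1).
rewrite (_ : (fun _ => _) = fun x => f x * f x ^+ k);
  first exact: sphere_boundedM.
by apply/funext => x; rewrite exprS.
Qed.

Lemma sphere_bounded_sum (J : Type) (s : seq J) (P : pred J) (F : J -> T -> R) :
  (forall j, sphere_bounded (F j)) -> sphere_bounded (fun x => \sum_(j <- s |
    P j) F j x).
Proof.
move=> hF; elim: s => [|j s ih].
  by rewrite (_ : (fun _ => _) = cst 0); [exact: sphere_bounded_cst|
    apply/funext => x; rewrite big_nil].
rewrite (_ : (fun _ => _) = fun x => (if P j then F j x else 0) +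
   \sum_(j <- s | P j) F j x).
  by apply: sphere_boundedD => //; case: (P j) => //;
    exact: (sphere_bounded_cst 0).
by apply/funext => x; rewrite big_cons; case: ifP; rewrite ?add0r.
Qed.

Lemma sphere_bounded_dot (z : 'cV[R]_d) : sphere_bounded (fun x =>
  dot (x : 'cV[R]_d) z).
Proof.
split; first exact: measurable_dot.
exists (Num.sqrt (dot z z)) => x /sphereP x1.
have := CauchySchwarz_dot x z; rewrite x1 mul1r => h.
by rewrite -sqrtr_sqr ler_wsqrtr.
Qed.

Lemma sphere_bounded_indic (A : set T) : measurable A -> sphere_bounded (\1_A).
Proof.
move=> mA; split; first exact: measurable_indic.
by exists 1 => x _; rewrite indicE normr_nat lern1; case: (_ \in _).
Qed.

Lemma sphere_bounded_integrable f : sphere_bounded f ->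
  mu.-integrable S (EFin \o f).
Proof.
move=> [mf [M hM]]; apply: measurable_bounded_integrable => //.
- by rewrite -ge0_fin_numE //; exact: fin_num_measure.
- exact: measurable_funTS.
exists M; split; first exact: num_real.
by move=> N MN x xS; apply: (le_trans (hM _ xS)); exact: ltW.
Qed.

Lemma sphere_mean_cst r : I (cst r) = r.
Proof.
rewrite /I /sphere_mean Rintegral_cst //.
have muS : mu S = 1%E by case: hmu.
by rewrite -[RHS]mulr1; congr (_ * _); exact: (congr1 fine muS).
Qed.

Lemma sphere_meanD f g : sphere_bounded f -> sphere_bounded g -> I (fun x =>
  f x + g x) = I f + I g.
Proof.
move=> nf ng; apply: RintegralD; [exact: measurable_sphere|..];
exact: sphere_bounded_integrable.
Qed.

Lemma sphere_meanZ r f : sphere_bounded f -> I (fun x => r * f x) = r * I f.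
Proof.
move=> nf; apply: RintegralZl; first exact: measurable_sphere.
exact: sphere_bounded_integrable.
Qed.

Lemma sphere_mean_sum (J : Type) (s : seq J) (F : J -> T -> R) :
  (forall j, sphere_bounded (F j)) ->
  I (fun x => \sum_(j <- s) F j x) = \sum_(j <- s) I (F j).
Proof.
move=> hF; elim: s => [|j s ih].
  rewrite big_nil -[RHS](sphere_mean_cst 0); congr I.
  by apply/funext => x; rewrite big_nil.
rewrite big_cons -ih -sphere_meanD //; last exact: sphere_bounded_sum.
by congr I; apply/funext => x; rewrite big_cons.
Qed.

Lemma eq_sphere_mean f g : (forall x, sphere x -> f x = g x) -> I f = I g.
Proof. by move=> fg; apply: eq_Rintegral => x; rewrite inE => /fg. Qed.

Lemma le_sphere_mean f g : sphere_bounded f -> sphere_bounded g ->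
  (forall x, sphere x -> f x <= g x) -> I f <= I g.
Proof.
move=> nf ng fg; apply: le_Rintegral => //.
  exact: sphere_bounded_integrable.
exact: sphere_bounded_integrable.
Qed.

Lemma sphere_mean_indic (A : set T) : measurable A -> A `<=` S ->
  I (\1_A) = fine (mu A).
Proof.
move=> mA AS; rewrite /I /sphere_mean /Rintegral integral_indic //.
by rewrite (setIidl AS).
Qed.

Lemma sphere_mean_orthogonal f (U : 'M[R]_d) : sphere_bounded f ->
  U^T *m U = 1%:M ->
  I (fun x => f (U *m (x : 'cV[R]_d))) = I f.
Proof.
move=> nf UU; pose phi (x : T) : T := U *m (x : 'cV[R]_d).
have mphi : measurable_fun setT phi by exact: measurable_mulmx.
have phiS : phi @^-1` S = S.
  have E x : dot (phi x : 'cV[R]_d) (phi x) = dot (x : 'cV[R]_d) x.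
    by rewrite dot_mulmx mulmxA UU mul1mx.
  by apply/seteqP; split => x /= /enorm_eq1 h; apply/enorm_eq1; rewrite -h E.
rewrite /I /sphere_mean /Rintegral; congr fine.
transitivity (\int[pushforward mu phi]_(x in S) (f x)%:E)%E.
  rewrite integral_pushforward //.
  - by rewrite phiS.
  - by apply/measurable_EFinP; case: nf.
  rewrite phiS; apply: sphere_bounded_integrable; case: nf => mf [M hM]; split.
    exact: (measurableT_comp mf mphi).
  by exists M => x; rewrite -{1}/S -phiS => /hM.
apply: eq_measure_integral => A mA _.
by case: hmu => _ /(_ U UU A mA).
Qed.

End SphereIntegral.

(** * Moments of a rotation-invariant measure *)

Lemma poly_ext_horner (R : numFieldType) (p q : {poly R}) :
  (forall b, p.[b] = q.[b]) -> p = q.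
Proof.
move=> pq; apply/eqP; rewrite -subr_eq0; apply/eqP.
apply: (@roots_geq_poly_eq0 _ _ [seq i%:R | i <- iota 0 (size (p - q)%R)]).
- by apply/allP => _ /mapP[i _ ->]; rewrite /root hornerD hornerN pq subrr.
- by rewrite map_inj_uniq ?iota_uniq // => i j /eqP; rewrite eqr_nat => /eqP.
- by rewrite size_map size_iota.
Qed.

Lemma coef2_exp_1DX2 (R : nzRingType) n : ((1 + 'X^2 : {poly R}) ^+ n)`_2 =
  n%:R.
Proof.
suff: ((1 + 'X^2 : {poly R}) ^+ n)`_0 = 1 /\ ((1 + 'X^2 : {poly R}) ^+ n)`_2 =
  n%:R.
  by case.
elim: n => [|n [ih0 ih2]]; first by rewrite expr0 !coef1.
rewrite exprS mulrDl mul1r !coefD !coefXnM /= subnn ih0 ih2 addr0; split=> //.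
by rewrite -natr1.
Qed.

Section SphereMoments.
Context {R : realType} {d : nat}.
Let T := borel_cV R d.
Variable mu : probability (borel_cV R d) R.
Hypothesis hmu : uniform_on_sphere mu.
Local Notation I := (sphere_mean mu).
Implicit Types (x z u w e : 'cV[R]_d).

(** This is the one place where rotation invariance enters the moments: an orthogonal map carries
    [z] to [z'], and transposition moves it onto [x]. *)
Lemma sphere_mean_radial (f : R -> R) z z' :
  sphere_bounded (fun x => f (dot (x : 'cV[R]_d) z)) -> dot z z = dot z' z' ->
  I (fun x => f (dot (x : 'cV[R]_d) z)) = I (fun x =>
    f (dot (x : 'cV[R]_d) z')).
Proof.
move=> nf /orthogonal_transitive[U UU Uz].
rewrite -(sphere_mean_orthogonal hmu nf UU); congr I; apply/funext => x.
by rewrite dot_mulmx Uz.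
Qed.

Definition moment z k := I (fun x => dot (x : 'cV[R]_d) z ^+ (2 * k)).

Lemma moment_scale e z k : dot e e = 1 -> moment z k = dot z z ^+ k * moment e
  k.
Proof.
move=> e1; rewrite /moment.
rewrite (@sphere_mean_radial (fun t => t ^+ (2 * k)) z (enorm z *: e)).
- rewrite -sphere_meanZ; last exact/sphere_boundedX/sphere_bounded_dot.
  by congr I; apply/funext => x; rewrite dotZr exprMn exprM enorm_sqr.
- exact/sphere_boundedX/sphere_bounded_dot.
- by rewrite dotZl dotZr e1 mulr1 -expr2 enorm_sqr.
Qed.

(* Compare the coefficients of [b ^+ 2] in
   [moment (u + b *: w) k.+1 = (1 + b ^+ 2) ^+ k.+1 * moment u k.+1]. *)
Lemma mixed_moment u w k : dot u u = 1 -> dot w w = 1 -> dot u w = 0 ->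
  (2 * k).+1%:R *
    I (fun x => dot (x : 'cV[R]_d) u ^+ (2 * k) * dot (x : 'cV[R]_d) w ^+ 2) =
  moment u k.+1.
Proof.
move=> u1 w1 uw.
pose c i := I (fun x => dot (x : 'cV[R]_d) u ^+ (2 * k.+1 - i) *
                        dot (x : 'cV[R]_d) w ^+ i).
have nc i : sphere_bounded (fun x => dot (x : 'cV[R]_d) u ^+ (2 * k.+1 - i) *
                        dot (x : 'cV[R]_d) w ^+ i).
  by apply: sphere_boundedM; apply/sphere_boundedX/sphere_bounded_dot.
pose p := \poly_(i < (2 * k.+1).+1) ('C(2 * k.+1, i)%:R * c i).
pose q : {poly R} := moment u k.+1 *: (1 + 'X^2) ^+ k.+1.
have pq : p = q.
  apply: poly_ext_horner => b.
  rewrite /q hornerZ horner_exp hornerD hornerXn hornerC mulrC.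
  have -> : 1 + b ^+ 2 = dot (u + b *: w) (u + b *: w).
    rewrite !(dotDl, dotDr, dotZl, dotZr) (dotC w) u1 w1 uw; ring.
  rewrite -moment_scale // horner_poly /moment.
  transitivity (I (fun x => \sum_(i < (2 * k.+1).+1) 'C(2 * k.+1,
    i)%:R * b ^+ i *
     (dot (x : 'cV[R]_d) u ^+ (2 * k.+1 - i) * dot (x : 'cV[R]_d) w ^+ i))).
    rewrite sphere_mean_sum //; last first.
      by move=> i; apply: sphere_boundedM => //; exact: (sphere_bounded_cst _).
    apply: eq_bigr => i _; rewrite sphere_meanZ // -/(c i); ring.
  congr I; apply/funext => x; rewrite dotDr dotZr exprDn; apply: eq_bigr => i _.
  by rewrite -mulr_natl exprMn; ring.
have := congr1 (fun r : {poly R} => r`_2) pq.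
rewrite /p /q coef_poly coefZ coef2_exp_1DX2.
have E2 : (2 * k.+1)%N = (2 * k).+2 by rewrite mulnS.
have -> : (2 < (2 * k.+1).+1)%N by rewrite E2.
have -> : 'C(2 * k.+1, 2) = (k.+1 * (2 * k).+1)%N.
  by rewrite bin2 {2}E2 [_.+2.-1]/= -mulnA mul2n doubleK.
move=> h; have k0 : k.+1%:R != 0 :> R by rewrite pnatr_eq0.
apply: (mulIf k0); rewrite -h /c E2 !subSS subn0 natrM; ring.
Qed.

(** Insert 1 = sum of the squared coordinates of x into the k-th moment along a basis vector. That
    vector itself contributes the next moment, and each of the d - 1 others a mixed moment, equal to
    the next moment divided by 2k + 1. *)
Lemma momentS e k : (0 < d)%N -> dot e e = 1 ->
  (2 * k + d)%:R * moment e k.+1 = (2 * k).+1%:R * moment e k.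
Proof.
move=> d0 e1; pose i0 := Ordinal d0.
pose E i : 'cV[R]_d := delta_mx i ord0.
have EE i j : dot (E i) (E j) = (i == j)%:R.
  rewrite /dot (bigD1 i) //= big1 => [|l li]; rewrite !mxE !eqxx ?andbT /=.
    by rewrite mul1r addr0.
  by rewrite (negbTE li) mul0r.
have dE x i : dot x (E i) = x i ord0.
  rewrite /dot (bigD1 i) //= big1 => [|l li]; rewrite !mxE !eqxx ?andbT /=.
    by rewrite mulr1 addr0.
  by rewrite (negbTE li) mulr0.
have mE j : moment e j = moment (E i0) j.
  by rewrite (@moment_scale (E i0)) ?EE ?eqxx // e1 expr1n mul1r.
rewrite !mE.
have nn i : sphere_bounded (fun x => dot (x : 'cV[R]_d) (E i0) ^+ (2 * k) *
     dot (x : 'cV[R]_d) (E i) ^+ 2).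
  by apply: sphere_boundedM; apply/sphere_boundedX/sphere_bounded_dot.
have -> : moment (E i0) k = \sum_i I (fun x => dot (x : 'cV[R]_d) (E i0) ^+ (2
  * k) *
     dot (x : 'cV[R]_d) (E i) ^+ 2).
  rewrite -sphere_mean_sum //; apply: eq_sphere_mean => x /sphereP x1.
  rewrite -mulr_sumr (_ : \sum_i _ = dot x x) ?x1 ?mulr1 //.
  by rewrite -x1; apply: eq_bigr => i _; rewrite dE expr2.
rewrite (bigD1 i0) //= mulrDr mulr_sumr (eq_bigr (fun=> moment (E i0) k.+1));
  last first.
  by move=> i ii0; rewrite mixed_moment ?EE ?eqxx // eq_sym (negbTE ii0).
rewrite sumr_const cardC1 card_ord.
have -> : I (fun x => dot (x : 'cV[R]_d) (E i0) ^+ (2 * k) *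
     dot (x : 'cV[R]_d) (E i0) ^+ 2) = moment (E i0) k.+1.
  by congr I; apply/funext => x; rewrite -exprD mulnS addnC.
rewrite -[_ *+ d.-1]mulr_natl -mulrDl -natrD; congr (_%:R * _).
by rewrite addSnnS prednK.
Qed.

(** The variable A of the overview; the factor d gives it mean 1 for unit [u]. *)
Definition sphere_sq u : T -> R := fun x => d%:R * dot (x : 'cV[R]_d) u ^+ 2.

Lemma sphere_bounded_sq u : sphere_bounded (sphere_sq u).
Proof. by apply: sphere_boundedM; [exact: (sphere_bounded_cst
  _)|exact/sphere_boundedX/sphere_bounded_dot]. Qed.

Lemma sphere_sq_ge0 u x : 0 <= sphere_sq u x.
Proof. by rewrite mulr_ge0 ?ler0n ?sqr_ge0. Qed.

Definition sphere_sq_moment u k := I (fun x => sphere_sq u x ^+ k).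
Local Notation M := sphere_sq_moment.

Lemma sphere_sq_momentE u k : M u k = d%:R ^+ k * moment u k.
Proof.
rewrite /M /moment -sphere_meanZ; last exact/sphere_boundedX/sphere_bounded_dot.
by congr I; apply/funext => x; rewrite /sphere_sq exprMn exprM.
Qed.

Lemma sphere_sq_moment0 u : M u 0 = 1.
Proof. exact: (sphere_mean_cst hmu). Qed.

(** As d grows this tends to the moment recursion of a squared Gaussian; a finite d only lowers the
    moments. *)
Lemma sphere_sq_momentS u k : (0 < d)%N -> dot u u = 1 ->
  (1 + (2 * k)%:R / d%:R) * M u k.+1 = (2 * k).+1%:R * M u k.
Proof.
move=> d0 u1; rewrite !sphere_sq_momentE.
rewrite [RHS]mulrCA -momentS // exprS natrD; field.
by rewrite pnatr_eq0 -lt0n.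
Qed.

Lemma sphere_sq_moment_ge0 u k : 0 <= M u k.
Proof. by apply: Rintegral_ge0 => x _; rewrite exprn_ge0 ?sphere_sq_ge0. Qed.

Lemma sphere_sq_moment_le u k : (0 < d)%N -> dot u u = 1 ->
  M u k <= 2 ^+ k * k`!%:R.
Proof.
move=> d0 u1; elim: k => [|k ih].
  by rewrite sphere_sq_moment0 expr0 mul1r.
have h := sphere_sq_momentS k d0 u1.
have h1 : M u k.+1 <= (2 * k).+1%:R * M u k.
  rewrite -h ler_peMl ?sphere_sq_moment_ge0 // lerDl divr_ge0 //.
apply: (le_trans h1); rewrite exprS factS natrM.
rewrite mulrACA ler_pM ?sphere_sq_moment_ge0 //.
by rewrite -natrM ler_nat mulnS add2n ltnW.
Qed.

(** Monotone convergence along the partial sums of the exponential series, so that only finitely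
    many moments are handled at a time. *)
Lemma sphere_mean_expR_le (f : T -> R) (B : R) : sphere_bounded f ->
  (forall x, sphere x -> 0 <= f x) ->
  (forall n, I (fun x => series (exp_coeff (f x)) n) <= B) ->
  I (fun x => expR (f x)) <= B.
Proof.
move=> nf f0 hB.
have ns n : sphere_bounded (fun x => series (exp_coeff (f x)) n).
  apply: sphere_bounded_sum => j.
  by apply: sphere_boundedM; [exact: sphere_boundedX|exact: (sphere_bounded_cst
    _)].
have ne : sphere_bounded (fun x => expR (f x)) by apply: sphere_bounded_comp =>
  //; exact: continuous_expR.
have mS := @measurable_sphere R d.
have fin g : sphere_bounded g -> (\int[mu]_(x in @sphere R d) (g x)%:E)%E = (I
  g)%:E.
  move=> ng; rewrite /sphere_mean /Rintegral fineK //.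
  by apply: integrable_fin_num => //; exact: sphere_bounded_integrable.
rewrite -lee_fin -fin //.
have -> : (\int[mu]_(x in @sphere R d) (expR (f x))%:E =
   \int[mu]_(x in @sphere R d) (limn (fun n => (series (exp_coeff (f x))
     n)%:E)))%E.
  by apply: eq_integral => x _; rewrite EFin_lim //;
    exact: is_cvg_series_exp_coeff.
rewrite monotone_convergence //.
- apply: lime_le.
    apply: ereal_nondecreasing_is_cvgn => i j ij; rewrite !fin // lee_fin.
    apply: le_sphere_mean => // x xS; apply: nondecreasing_series => // k _ _.
    by rewrite exp_coeff_ge0 // f0.
  by apply: nearW => n; rewrite fin // lee_fin.
- move=> n; apply/measurable_EFinP; apply: measurable_funTS; by case: (ns n).
- by move=> n x xS; rewrite lee_fin sumr_ge0 // => i _;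
  rewrite exp_coeff_ge0 // f0.
- move=> x xS i j ij; rewrite lee_fin; apply: nondecreasing_series => // k _ _.
  by rewrite exp_coeff_ge0 // f0.
Qed.

(** By the moment bounds the k-th term of the series has mean at most 4^(-k) 2^k = 2^(-k). *)
Lemma sphere_sq_exp_moment u : (0 < d)%N -> dot u u = 1 ->
  I (fun x => expR (sphere_sq u x / 4)) <= 2.
Proof.
move=> d0 u1; apply: sphere_mean_expR_le.
- by apply: sphere_boundedM; [exact: sphere_bounded_sq|exact:
  (sphere_bounded_cst _)].
- by move=> x _; rewrite divr_ge0 ?sphere_sq_ge0.
move=> n; rewrite /series /=.
have nX k : sphere_bounded (fun x => sphere_sq u x ^+ k) by
  exact/sphere_boundedX/sphere_bounded_sq.
apply: (@le_trans _ _ (\sum_(0 <= k < n) 2^-1 ^+ k)).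
  rewrite (_ : I _ = \sum_(0 <= k < n) (4^-1 ^+ k / k`!%:R) * M u k);
    last first.
    rewrite [RHS](eq_bigr (fun k => I (fun x => 4^-1 ^+ k / k`!%:R * sphere_sq
      u x ^+ k))).
      rewrite -sphere_mean_sum //; last first.
        by move=> k; apply: sphere_boundedM => //; exact: (sphere_bounded_cst
          _).
      congr I; apply/funext => x; apply: eq_bigr => k _.
      by rewrite /exp_coeff /= exprMn; ring.
    by move=> k _; rewrite sphere_meanZ.
  apply: ler_sum => k _.
  have -> : 2^-1 ^+ k = 4^-1 ^+ k / k`!%:R * (2 ^+ k * k`!%:R) :> R.
    rewrite (_ : 2^-1 = 4^-1 * 2) ?exprMn; last by field.
    by field; rewrite pnatr_eq0 -lt0n fact_gt0.
  apply: ler_wpM2l; last exact: sphere_sq_moment_le.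
  by rewrite mulr_ge0 ?invr_ge0 ?exprn_ge0 ?invr_ge0.
rewrite big_mkord.
have : (1 - 2^-1) * \sum_(i < n) 2^-1 ^+ i = 1 - 2^-1 ^+ n :> R.
  by rewrite -[1 - 2^-1]opprB mulNr -subrX1 opprB.
have : 0 <= 2^-1 ^+ n :> R by rewrite exprn_ge0 ?invr_ge0.
lra.
Qed.

End SphereMoments.

(** * The deviation from 1/2 *)

(** From exp(-y) >= 1 - y follows exp y <= 1 + y exp y; this bound is then inserted into its own
    right-hand side. *)
Lemma expR_le_quadratic (R : realType) (y : R) : 0 <= y ->
  expR y <= 1 + y + y ^+ 2 * expR y.
Proof.
move=> y0; have h : expR y <= 1 + y * expR y.
  have := expR_ge1Dx (- y); rewrite expRN -(ler_pM2r (expR_gt0 y)).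
  by rewrite mulVf ?gt_eqF ?expR_gt0 //; lra.
apply: (le_trans h); rewrite -addrA lerD2l.
rewrite -[X in _ <= X + _]mulr1 expr2 -mulrA -mulrDr; exact: ler_wpM2l.
Qed.

Section Deviation.
Context {R : realType} {d : nat}.
Let T := borel_cV R d.
Variable mu : probability (borel_cV R d) R.
Hypothesis hmu : uniform_on_sphere mu.
Hypothesis d0 : (0 < d)%N.
Local Notation I := (sphere_mean mu).
Variable u : 'cV[R]_d.
Hypothesis u1 : dot u u = 1.

Definition sphere_dev (x : T) : R := `|sphere_sq u x - 1 / 2|.
Local Notation h := sphere_dev.

Lemma sphere_bounded_dev : sphere_bounded h.
Proof.
apply: (@sphere_bounded_comp _ _ (fun x => sphere_sq u x - 1 / 2) Num.norm).
  by move=> x; exact: norm_continuous.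
by apply: sphere_boundedD; [exact: sphere_bounded_sq|exact: (sphere_bounded_cst
  (- (1 / 2)))].
Qed.

(* The cubic [g = 1 - A + A^2/5 - A^3/105] minimizes [E g(A)^2] subject to
   [g 0 = 1] when [A] is the square of a standard Gaussian; the minimum
   [16/35 < 1/2] bounds [E g(A)^2] on the sphere in every dimension. *)
Lemma sphere_dev_le_poly (A : R) : 0 <= A ->
  `|A - 1 / 2| <= A - 1 / 2 + (1 - A + A ^+ 2 / 5 - A ^+ 3 / 105) ^+ 2.
Proof.
move=> A0; have [A1|A1] := leP (1 / 2) A.
  by rewrite ger0_norm ?subr_ge0 // lerDl sqr_ge0.
rewrite ltr0_norm ?subr_lt0 //.
(* For A < 1/2 the goal reads 1 - 2A <= g^2. It follows from g >= 1 - A >= 0, as (1 - A)^2 = 1 - 2A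
   + A^2. *)
have g1 : 1 - A <= 1 - A + A ^+ 2 / 5 - A ^+ 3 / 105.
  rewrite -subr_ge0; have -> : 1 - A + A ^+ 2 / 5 - A ^+ 3 / 105 - (1 - A) =
     A ^+ 2 * (1 / 5 - A / 105) by field.
  by apply: mulr_ge0; [exact: sqr_ge0|lra].
set g := (X in _ <= _ + X ^+ 2); rewrite -/g in g1.
have : 0 <= (g - (1 - A)) * (g + (1 - A)) by apply: mulr_ge0; lra.
have := sqr_ge0 A; nra.
Qed.

Lemma sphere_dev_mean : I h <= 67 / 70.
Proof.
have nX k : sphere_bounded (fun x => sphere_sq u x ^+ k) by
  exact/sphere_boundedX/sphere_bounded_sq.
(* The coefficients of A - 1/2 + g(A)^2. *)
pose a : seq R := [:: 1 / 2; - 1; 7 / 5; - (44 / 105); 31 / 525; - (2 / 525);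
  1 / 11025].
have na (k : 'I_7) : sphere_bounded (fun x => a`_k * sphere_sq u x ^+ k).
  by apply: sphere_boundedM => //; exact: (sphere_bounded_cst _).
have h1 : I h <= \sum_(k < 7) a`_k * sphere_sq_moment mu u k.
  rewrite (eq_bigr (fun k : 'I_7 => I (fun x => a`_k * sphere_sq u x ^+ k)));
    last first.
    by move=> k _; rewrite sphere_meanZ.
  rewrite -sphere_mean_sum //.
  apply: le_sphere_mean; [exact: sphere_bounded_dev|exact:
    sphere_bounded_sum|move=> x _].
  apply: (le_trans (sphere_dev_le_poly (sphere_sq_ge0 u x))).
  by rewrite le_eqVlt; apply/orP; left; apply/eqP;
    rewrite !big_ord_recl big_ord0 /= /bump /=; field.
apply: (le_trans h1).
rewrite !big_ord_recl big_ord0 /= /bump /= !add1n.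
pose p : R := d%:R^-1.
have p0 : 0 <= p by rewrite invr_ge0.
have m6 := sphere_sq_moment_ge0 mu u 6.
have := sphere_sq_momentS hmu 0 d0 u1; have := sphere_sq_momentS hmu 1 d0 u1.
have := sphere_sq_momentS hmu 2 d0 u1; have := sphere_sq_momentS hmu 3 d0 u1.
have := sphere_sq_momentS hmu 4 d0 u1; have := sphere_sq_momentS hmu 5 d0 u1.
rewrite (sphere_sq_moment0 hmu) -/p !muln0 /= mul0r addr0.
move: m6; set m1 := sphere_sq_moment _ _ 1; set m2 := sphere_sq_moment _ _ 2.
set m3 := sphere_sq_moment _ _ 3; set m4 := sphere_sq_moment _ _ 4.
set m5 := sphere_sq_moment _ _ 5; set m6 := sphere_sq_moment _ _ 6.
move=> m60 e5 e4 e3 e2 e1 e0.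
(* Read backwards, the recursion writes m2 to m5, and through [E0] even the constant 1, as m6 times
   a polynomial in p = 1/d. The claim thus becomes a polynomial inequality in p. *)
have E1 : m1 = 1 by move: e0; rewrite !mul1r.
have E5 : m5 = (1 + 10 * p) * m6 / 11 by rewrite e5; field.
have E4 : m4 = (1 + 8 * p) * m5 / 9 by rewrite e4; field.
have E3 : m3 = (1 + 6 * p) * m4 / 7 by rewrite e3; field.
have E2 : m2 = (1 + 4 * p) * m3 / 5 by rewrite e2; field.
have E0 : 1 = (1 + 2 * p) * m2 / 3 by rewrite e1 E1; field.
rewrite E1 !mulr1 -subr_ge0.
(* Here 10395 = 3 * 5 * 7 * 9 * 11. The factor p appears because the bound is an equality in the
   Gaussian limit p = 0. *)
suff -> : 67 / 70 - (1 / 2 + (- 1 + (7 / 5 * m2 + (- (44 / 105) * m3 +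
    (31 / 525 * m4 + (- (2 / 525) * m5 + (1 / 11025 * m6 + 0))))))) =
   m6 / 10395 * (24 / 35 * p) *
   (2 - 17 * p + 679 * p ^+ 2 - 2444 * p ^+ 3 + 8160 * p ^+ 4).
  apply: mulr_ge0.
    apply: mulr_ge0; first by apply: divr_ge0 m60 (ler0n _ _).
    by apply: mulr_ge0 p0; apply: divr_ge0; exact: ler0n.
  (* Two completed squares, one absorbing the linear term and one the cubic term, leave a positive
     multiple of p^2. *)
  have -> : 2 - 17 * p + 679 * p ^+ 2 - 2444 * p ^+ 3 + 8160 * p ^+ 4 =
    2 * (1 - 17 / 4 * p) ^+ 2 + p ^+ 2 * (8160 * (p - 611 / 4080) ^+ 2 +
      (679 - 289 / 8 - 611 ^+ 2 / 2040)) by field.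
  apply: addr_ge0; first by apply: mulr_ge0 (ler0n _ _) (sqr_ge0 _).
  apply: mulr_ge0 (sqr_ge0 _) _.
  apply: addr_ge0; first by apply: mulr_ge0 (ler0n _ _) (sqr_ge0 _).
  lra.
have -> : 67 / 70 - (1 / 2 + (- 1 + (7 / 5 * m2 + (- (44 / 105) * m3 +
    (31 / 525 * m4 + (- (2 / 525) * m5 + (1 / 11025 * m6 + 0))))))) =
  (67 / 70 + 1 / 2) * 1 - (7 / 5 * m2 + (- (44 / 105) * m3 +
    (31 / 525 * m4 + (- (2 / 525) * m5 + 1 / 11025 * m6)))) by field.
by rewrite [X in _ * X - _]E0 E2 E3 E4 E5; field.
Qed.

(** Second-order expansion: the linear term is controlled by [sphere_dev_mean]. In the remainder, s
    <= 1/8 and h^2 <= 256 exp(h/8) leave 256 s^2 exp(h/4), at most 512 s^2 exp(A/4), whose mean is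
    at most 1024 s^2. *)
Lemma sphere_dev_laplace (s : R) : 0 <= s -> s <= 1 / 8 ->
  I (fun x => expR (s * h x)) <= expR (67 / 70 * s + 1024 * s ^+ 2).
Proof.
move=> s0 s1; apply: le_trans (expR_ge1Dx _).
have nh := sphere_bounded_dev.
have nA : sphere_bounded (fun x => expR (sphere_sq u x / 4)).
  apply: (@sphere_bounded_comp _ _ (fun x => sphere_sq u x / 4) expR);
    first exact: continuous_expR.
  by apply: sphere_boundedM; [exact: sphere_bounded_sq|exact:
    (sphere_bounded_cst _)].
have pw (x : T) : expR (s * h x) <= (1 + s * h x) + 512 * s ^+ 2 * expR
  (sphere_sq u x / 4).
  have h0 : 0 <= h x by exact: normr_ge0.
  have A0 := sphere_sq_ge0 u x.
  apply: (le_trans (expR_le_quadratic (mulr_ge0 s0 h0))); rewrite lerD2l.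
  have a1 : expR (s * h x) <= expR (h x / 8).
    by rewrite ler_expR mulrC ler_wpM2l //; lra.
  have a2 : h x ^+ 2 <= 256 * expR (h x / 8).
    have := expR_ge1Dx (h x / 16) => b1.
    have -> : expR (h x / 8) = expR (h x / 16) ^+ 2.
      by rewrite expr2 -expRD; congr expR; field.
    have -> : 256 = 16 ^+ 2 :> R by rewrite -natrX.
    by rewrite -exprMn ler_sqr ?nnegrE //; lra.
  have a3 : expR (h x / 4) <= 2 * expR (sphere_sq u x / 4).
    apply: (@le_trans _ _ (expR (1 / 8 + sphere_sq u x / 4))).
      have := ler_normB (sphere_sq u x) (1 / 2); rewrite -/(h x).
      rewrite (ger0_norm A0) ger0_norm ?ler_expR; lra.
    rewrite expRD ler_pM2r ?expR_gt0 //.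
    have := expR_ge1Dx (- (1 / 8) : R); rewrite expRN => b1.
    have e0 : 0 < expR (1 / 8) :> R by exact: expR_gt0.
    by have := ler_wpM2r (ltW e0) b1; rewrite mulVf ?gt_eqF //; lra.
  have a4 : expR (h x / 8) * expR (h x / 8) = expR (h x / 4).
    by rewrite -expRD; congr expR; field.
  rewrite exprMn -[leLHS]mulrA (mulrC 512) -[leRHS]mulrA.
  apply: ler_wpM2l; first exact: sqr_ge0.
  apply: (@le_trans _ _ (256 * expR (h x / 8) * expR (h x / 8))).
    by apply: ler_pM => //; rewrite ?sqr_ge0 ?expR_ge0.
  by rewrite -mulrA a4; lra.
apply: (@le_trans _ _ (I (fun x => (1 + s * h x) + 512 * s ^+ 2 * expR
  (sphere_sq u x / 4)))).
  apply: le_sphere_mean => //.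
    apply: (@sphere_bounded_comp _ _ (fun x => s * h x) expR);
      first exact: continuous_expR.
    by apply: sphere_boundedM => //; exact: (sphere_bounded_cst s).
  apply: sphere_boundedD; last by apply: sphere_boundedM => //;
    exact: (sphere_bounded_cst _).
  by apply: sphere_boundedD; [exact: (sphere_bounded_cst 1)|apply:
    sphere_boundedM => //; exact: (sphere_bounded_cst s)].
have nsh : sphere_bounded (fun x => s * h x) by apply: sphere_boundedM => //;
  exact: (sphere_bounded_cst s).
rewrite sphere_meanD; last first.
- by apply: sphere_boundedM => //; exact: (sphere_bounded_cst _).
- by apply: sphere_boundedD => //; exact: (sphere_bounded_cst 1).
rewrite (@sphere_meanD _ _ _ (cst 1)) //; last exact: sphere_bounded_cst.
rewrite (sphere_mean_cst hmu) !sphere_meanZ //.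
have := sphere_dev_mean; have := sphere_sq_exp_moment hmu d0 u1 => b1 b2.
have c1 := ler_wpM2l s0 b2.
have c2 : 512 * s ^+ 2 * I (fun x => expR (sphere_sq u x / 4)) <= 512 * s ^+ 2
  * 2.
  by apply: ler_wpM2l b1; apply: mulr_ge0 (ler0n _ _) (sqr_ge0 _).
rewrite -addrA lerD2l; apply: lerD; first by rewrite [67 / 70 * s]mulrC.
by apply: (le_trans c2); rewrite mulrAC; lra.
Qed.

End Deviation.

(** * Chernoff bound *)

Section UnionBound.
Context {R : realType} {dO : measure_display} {Omega : measurableType dO}.
Variable P : probability Omega R.

Lemma union_bound (J : finType) (Q : pred J) (A : J -> set Omega) :
  (forall j, measurable (A j)) ->
  measurable (\big[setU/set0]_(j | Q j) A j) /\
  fine (P (\big[setU/set0]_(j | Q j) A j)) <= \sum_(j | Q j) fine (P (A j)).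
Proof.
move=> mA; elim/big_rec2: _ => [|j r U _ [mU ih]].
  by rewrite measure0.
split; first exact: measurableU.
apply: le_trans (lerD (lexx _) ih).
rewrite -fineD ?fin_num_measure // fine_le ?fin_numD ?fin_num_measure //.
- exact: measurableU.
- exact: measureU2.
Qed.

Lemma bigsetU_mem (J : finType) (Q : pred J) (A : J -> set Omega) j w :
  Q j -> A j w -> (\big[setU/set0]_(j | Q j) A j) w.
Proof. by move=> Qj Ajw; rewrite (bigD1 j) //=; left. Qed.

End UnionBound.

Section Bins.
Context {R : realType} {d : nat}.
Let T := borel_cV R d.
Variable u : 'cV[R]_d.

Definition dev_bin (k : nat) : set T :=
  sphere `&` [set x | Num.truncn (140 * sphere_dev u x) = k].

Lemma measurable_dev_bin k : measurable (dev_bin k).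
Proof.
have mf : measurable_fun setT (fun x : T => 140 * sphere_dev u x).
  by apply: measurable_funM => //; case: (sphere_bounded_dev u).
rewrite (_ : dev_bin k = sphere `&`
   ([set x | 140 * sphere_dev u x < k.+1%:R] `\` [set x |
     140 * sphere_dev u x < k%:R])).
  apply: measurableI; first exact: measurable_sphere.
  by apply: measurableD; exact: measurable_preimage_lt.
apply/seteqP; split => x [xS /= hx]; split=> //=.
  have h0 : 0 <= 140 * sphere_dev u x by rewrite mulr_ge0 ?normr_ge0.
  have /andP[h1 h2] := truncn_itv h0; rewrite hx in h1 h2; split=> //.
  by apply/negP; rewrite -leNgt.
by case: hx => h1 /negP; rewrite -leNgt => h2; apply: truncn_def; rewrite h2 h1.
Qed.

(** Using the right end of each bin instead of the left costs the factor exp(s/140). With left ends,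
    at most one indicator is nonzero at each point of the sphere, and the sum is dominated by exp(s
    h). *)
Lemma dev_bin_laplace (mu : probability (borel_cV R d) R) (s : R) (L : nat) :
  uniform_on_sphere mu -> (0 < d)%N -> dot u u = 1 -> 0 <= s -> s <= 1 / 8 ->
  \sum_(k < L) expR (s * (k.+1%:R / 140)) * fine (mu (dev_bin k)) <=
    expR (s / 140 + (67 / 70 * s + 1024 * s ^+ 2)).
Proof.
move=> hmu d0 u1 s0 s1.
have mB k := measurable_dev_bin k.
have nB k := sphere_bounded_indic (mB k).
rewrite expRD; apply: le_trans (ler_wpM2l (expR_ge0 _) (sphere_dev_laplace hmu
  d0 u1 s0 s1)).
have nsh : sphere_bounded (fun x => expR (s * sphere_dev u x)).
  apply: (@sphere_bounded_comp _ _ (fun x => s * sphere_dev u x) expR);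
    first exact: continuous_expR.
  by apply: sphere_boundedM; [exact: (sphere_bounded_cst s)|exact:
    sphere_bounded_dev].
have nb (k : 'I_L) : sphere_bounded (fun x => expR (s * (k%:R / 140)) *
  \1_(dev_bin k) x).
  by apply: sphere_boundedM => //; exact: (sphere_bounded_cst _).
have -> : \sum_(k < L) expR (s * (k.+1%:R / 140)) * fine (mu (dev_bin k)) =
   expR (s / 140) * sphere_mean mu (fun x => \sum_(k < L) expR (s * (k%:R /
     140)) * \1_(dev_bin k) x).
  rewrite sphere_mean_sum // mulr_sumr; apply: eq_bigr => k _.
  rewrite sphere_meanZ // sphere_mean_indic //; last by move=> x [].
  rewrite mulrA -expRD -natr1; congr (expR _ * _); by field.
apply: ler_wpM2l; first exact: expR_ge0.
apply: le_sphere_mean => //; first exact: sphere_bounded_sum.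
move=> x xS; have h0 : 0 <= 140 * sphere_dev u x by rewrite mulr_ge0 ?normr_ge0.
have /andP[h1 _] := truncn_itv h0; move: h1; set t := Num.truncn _ => h1.
have e0 (k : nat) : k != t -> \1_(dev_bin k) x = 0 :> R.
  by move=> kt; rewrite indicE memNset // => -[_ /= tk];
    rewrite /t tk eqxx in kt.
have [tL|tL] := ltnP t L; last first.
  rewrite big1 ?expR_ge0 // => k _; rewrite e0 ?mulr0 //.
  by rewrite ltn_eqF // (leq_trans (ltn_ord k)).
rewrite (bigD1 (Ordinal tL)) //= big1 => [|k kt]; last by rewrite e0 ?mulr0.
rewrite addr0 indicE; apply: (@le_trans _ _ (expR (s * (t%:R / 140)))).
  by apply: ler_piMr; [exact: expR_ge0|case: (_ \in _)].
by rewrite ler_expR ler_wpM2l // ler_pdivrMr // mulrC.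
Qed.

End Bins.

Section Chernoff.
Context {R : realType} {d n : nat}.
Context {dO : measure_display} {Omega : measurableType dO}.
Variables (P : probability Omega R) (v : 'I_n -> {RV P >-> borel_cV R d}).
Hypothesis v_indep : mutually_independent v.
Hypothesis v_unif : forall j, uniform_on_sphere (distribution P (v j)).
Hypothesis d0 : (0 < d)%N.
Variable u : 'cV[R]_d.
Hypothesis u1 : dot u u = 1.

(** Chosen so that 1024 s^2 = s/140, the same as the rounding loss of the bins. Of the gap 69/70 -
    67/70 = 4/140 these two losses leave 2/140, whence the rate 2s/140. *)
Let s : R := (140 * 1024)^-1.

(* Replacing each deviation by its upper value on a bin of width [1 / 140]
   turns the Chernoff bound into finite sums, to which the product rule for
   events applies directly. *)
Lemma sphere_dev_chernoff : exists2 B : set Omega, measurable B &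
  (forall w, (forall j, sphere (v j w)) ->
     69 / 70 * n%:R < \sum_j sphere_dev u (v j w) -> B w) /\
  fine (P B) <= expR (- (2 * (140 ^+ 2 * 1024)^-1 * n%:R)).
Proof.
(* On the sphere the deviation is at most d + 1/2 < d + 1, so these bins cover all its values. *)
pose L := (140 * d.+1)%N.
have s0 : 0 < s by rewrite invr_gt0; apply: mulr_gt0; rewrite ltr0n.
have s1 : s <= 1 / 8 by rewrite /s; lra.
pose Q (c : {ffun 'I_n -> 'I_L}) := 69 / 70 * n%:R < \sum_j ((c j).+1%:R / 140
  : R).
pose A (c : {ffun 'I_n -> 'I_L}) : set Omega :=
  [set w | forall i, i \in [set: 'I_n]%SET -> dev_bin u (c i) (v i w)].
pose p i k : R := fine (distribution P (v i) (dev_bin u k)).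
have p0 i k : 0 <= p i k by exact: fine_ge0.
have AE c : P (A c) = (\prod_i p i (c i))%:E.
  have mBc i : i \in [set: 'I_n]%SET -> measurable (dev_bin u (c i)).
    by move=> _; exact: measurable_dev_bin.
  have -> := v_indep mBc.
  rewrite (big_morph EFin (id1 := 1%E) (op1 := *%E)) //.
  apply: eq_big => [i|i _]; first by rewrite inE.
  rewrite /p fineK //.
  by apply: fin_num_measure; exact: measurable_dev_bin.
have mA c : measurable (A c).
  rewrite (_ : A c = \bigcap_(i in [set: 'I_n]) (v i @^-1` dev_bin u (c i))).
    apply: fin_bigcap_measurable => // i _.
    by apply: measurable_funPTI; exact: measurable_dev_bin.
  by apply/seteqP; split => w h i _; apply: h; rewrite ?inE.
have [mB PB] := @union_bound _ _ _ P _ Q A mA.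
exists (\big[setU/set0]_(c | Q c) A c) => //; split.
  move=> w vS hw.
  have tL j : (Num.truncn (140 * sphere_dev u (v j w)) < L)%N.
    have h0 : 0 <= 140 * sphere_dev u (v j w) by rewrite mulr_ge0 ?normr_ge0.
    rewrite truncn_lt_nat // /L natrM ltr_pM2l ?ltr0n //.
    apply: (@le_lt_trans _ _ (d%:R + 1 / 2)).
      apply: (le_trans (ler_normB _ _)); rewrite !ger0_norm ?sphere_sq_ge0 //.
      rewrite lerD2r /sphere_sq ler_piMr //.
      by have := CauchySchwarz_dot (v j w : 'cV[R]_d) u;
        rewrite u1 (sphereP (vS j)) mulr1.
    by rewrite -[d.+1%:R]natr1 ltrD2l; lra.
  apply: (bigsetU_mem (j := [ffun j => Ordinal (tL j)])); last first.
    by move=> j _; split; [exact: vS|rewrite ffunE].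
  apply: (lt_le_trans hw); apply: ler_sum => j _; rewrite ffunE /=.
  rewrite ler_pdivlMr ?ltr0n // mulrC; apply: ltW; exact: truncnS_gt.
apply: (le_trans PB).
pose W (i : 'I_n) (k : 'I_L) := expR (s * (k.+1%:R / 140)) * p i k.
(* Exponential Markov inequality, applied to bin configurations: a bad one has weight at least 1,
   and the good ones are added for free. The sum over all configurations then factors over the
   vectors. *)
apply: (@le_trans _ _ (expR (- (s * (69 / 70 * n%:R))) *
   \sum_(c : {ffun 'I_n -> 'I_L}) \prod_i W i (c i))).
  rewrite mulr_sumr [leLHS]big_mkcond; apply: ler_sum => c _.
  have -> : \prod_i W i (c i) =
      expR (s * \sum_j ((c j).+1%:R / 140)) * \prod_i p i (c i).
    by rewrite mulr_sumr expR_sum -big_split.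
  rewrite mulrA -expRD AE /=.
  have pp : 0 <= \prod_i p i (c i) by apply: prodr_ge0.
  case: ifP => [Qc|_]; last by rewrite mulr_ge0 ?expR_ge0.
  apply: ler_peMl => //; rewrite -[leLHS]expR0 ler_expR addrC subr_ge0.
  by rewrite ler_pM2l //; exact: ltW.
rewrite -(bigA_distr_bigA W).
apply: (@le_trans _ _ (expR (- (s * (69 / 70 * n%:R))) *
   \prod_(i < n) expR (s / 140 + (67 / 70 * s + 1024 * s ^+ 2)))).
  apply: ler_wpM2l; first exact: expR_ge0.
  apply: ler_prod => i _; rewrite sumr_ge0 /=; last first.
    by move=> k _; rewrite mulr_ge0 ?expR_ge0.
  exact: (dev_bin_laplace L (v_unif i) d0 u1 (ltW s0) s1).
rewrite prodr_const card_ord -expRM_natl -expRD ler_expR.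
rewrite le_eqVlt; apply/orP; left; apply/eqP.
have s2 : 1024 * s ^+ 2 = s / 140 by rewrite /s; field.
have s3 : (140 ^+ 2 * 1024)^-1 = s / 140 by rewrite /s; field.
by rewrite s2 s3; field.
Qed.

End Chernoff.

(** * Measurability of the expansion event *)

Section Measurability.
Context {R : realType} {d n : nat}.

Lemma continuous_sum_fun (X : topologicalType) (J : Type) (r : seq J)
    (F : J -> X -> R) :
  (forall j, continuous (F j)) -> continuous (fun x => \sum_(j <- r) F j x).
Proof.
move=> cF; elim: r => [|j r ih] x.
  under eq_fun do rewrite big_nil; exact: cvg_cst.
by under eq_fun do rewrite big_cons; apply: continuousD; [exact: cF|exact: ih].
Qed.

(** By [opnorm_leP] the set is an intersection of closed conditions on [V], one for each triple (y,
    x, z). Closedness is what makes the event measurable although uncountably many [y] are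
    involved. *)
Lemma closed_inf_expansion (lam : R) :
  closed [set V : 'M[R]_(d, n) | inf_expansion lam V].
Proof.
pose D :=
  [set p : 'cV[R]_n * ('cV[R]_d * 'cV[R]_d) | [/\ \sum_j p.1 j ord0 = 0, `|p.1|
    <= 1, dot p.2.1 p.2.1 <= 1 &
                dot p.2.2 p.2.2 <= 1]].
pose f (p : 'cV[R]_n * ('cV[R]_d * 'cV[R]_d)) (V : 'M[R]_(d, n)) :=
  frame_size V * ((1 - lam) / d%:R) +
  (-1) * weighted_form (fun j => col j V) p.1 p.2.1 p.2.2.
rewrite (_ : mkset _ = \bigcap_(p in D) (f p @^-1` [set t | 0 <= t]));
  last first.
  apply/seteqP; split => [V hV [y [x z]] /= [/= y0 y1 x1 z1]|V hV y y0 y1].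
    have /opnorm_leP := hV y y0 y1; move=> /(_ x z x1 z1).
    by rewrite weighted_formE /f /= -mulrA mulN1r subr_ge0.
  apply/opnorm_leP => x z x1 z1; rewrite weighted_formE -mulrA.
  have := hV (y, (x, z)); rewrite /f /= mulN1r subr_ge0; apply; split => //.
apply: closed_bigI => p _; apply: preimage_closed; last exact: closed_ge.
suff cf : continuous (f p) by move=> V _; exact: cf.
have c1 : continuous (@frame_size R d n).
  rewrite (_ : @frame_size R d n = fun V => \sum_i \sum_j V i j * V i j).
    apply: continuous_sum_fun => i; apply: continuous_sum_fun => j V.
    exact: (cvgM (@coord_continuous _ _ _ i j V) (@coord_continuous _ _ _ i j
      V)).
  apply/funext => V; rewrite /frame_size /frobenius sqr_sqrtr.
    by apply: eq_bigr => i _; apply: eq_bigr => j _; rewrite expr2.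
  by apply: sumr_ge0 => i _; apply: sumr_ge0 => j _; exact: sqr_ge0.
have cdot (x : 'cV[R]_d) j : continuous (fun V : 'M[R]_(d, n) =>
  dot (col j V) x).
  rewrite (_ : (fun _ => _) = fun V : 'M[R]_(d, n) => \sum_i V i j * x i ord0).
    apply: continuous_sum_fun => i V.
    exact: (cvgM (@coord_continuous _ _ _ i j V) (cvg_cst _)).
  by apply/funext => V; apply: eq_bigr => i _; rewrite mxE.
have c2 : continuous (fun V : 'M[R]_(d, n) =>
    weighted_form (fun j => col j V) p.1 p.2.1 p.2.2).
  apply: continuous_sum_fun => j V.
  exact: (cvgM (cvg_cst _) (cvgM (cdot _ j V) (cdot _ j V))).
move=> V.
exact: (cvgD (cvgM (c1 V) (cvg_cst _)) (cvgM (cvg_cst _) (c2 V))).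
Qed.

Context {dO : measure_display} {Omega : measurableType dO}.
Variables (P : probability Omega R) (v : 'I_n -> {RV P >-> borel_cV R d}).

Lemma measurable_inf_expansion (lam : R) :
  measurable [set w | inf_expansion lam (matrix_of_columns (fun j => v j w))].
Proof.
pose V w : 'M[R]_(d, n) := matrix_of_columns (fun j => v j w).
rewrite -[X in measurable X]setCK; apply: measurableC.
apply: (@measurable_preimage_open _ _ _ d n V _ (~` [set A |
  inf_expansion lam A])).
  move=> i j; rewrite (_ : (fun w => V w i j) =
      (fun x : borel_cV R d => (x : 'cV[R]_d) i ord0) \o v j).
    by apply: measurableT_comp => //; exact: measurable_coord.
  by apply/funext => w; rewrite /V mxE.
by apply: closed_openC; exact: closed_inf_expansion.
Qed.

(** Reduces the event with some [lam >= lam0] to the single value [lam0]. *)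
Lemma inf_expansion_le (V : 'M[R]_(d, n)) (lam lam' : R) : lam <= lam' ->
  inf_expansion lam' V -> inf_expansion lam V.
Proof.
move=> ll hV y y0 y1; apply: (le_trans (hV y y0 y1)).
by rewrite ler_wpM2r ?invr_ge0 // ler_wpM2l ?sqr_ge0 // lerD2l lerN2.
Qed.

End Measurability.

(** * From the net to expansion *)

Lemma le_mx_norm (R : realType) m n (A : 'M[R]_(m, n)) i j : `|A i j| <= `|A|.
Proof.
by rewrite [leRHS]/Num.norm /= mx_normrE; apply/bigmax_geP; right; exists (i,
  j).
Qed.

Lemma inf_expansion_from_net (R : realType) (d n m : nat) (v : 'I_n ->
  'cV[R]_d) :
  (0 < d)%N -> m%:R = 350 :> R -> (forall j, dot (v j) (v j) = 1) ->
  (forall k : net_index d (m * d), (net_weight k <= m * d)%N ->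
     net_point R m k != 0 ->
     \sum_j sphere_dev ((enorm (net_point R m k))^-1 *: net_point R m k) (v j)
       <= 69 / 70 * n%:R) ->
  inf_expansion (1 / 139) (matrix_of_columns v).
Proof.
move=> d0 m350 v1 hv y y0 y1.
have colE j : col j (matrix_of_columns v) = v j.
  by apply/matrixP => i l; rewrite (ord1 l) !mxE.
under eq_bigr do rewrite colE.
have -> : frame_size (matrix_of_columns v) = n%:R.
  rewrite /frame_size /frobenius sqr_sqrtr; last first.
    by apply: sumr_ge0 => i _; apply: sumr_ge0 => j _; exact: sqr_ge0.
  rewrite exchange_big /= (eq_bigr (fun=> 1)) ?sumr_const ?card_ord // => j _.
  by rewrite -(v1 j); apply: eq_bigr => i _; rewrite mxE expr2.
have dR : 0 < d%:R :> R by rewrite ltr0n.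
have m0 : (0 < m)%N by rewrite -(ltr0n R) m350 ltr0n.
(* Mesh 1/350 makes the net loss 1 - 1/140, and (69/70)(140/139) = 138/139. *)
have -> : n%:R * (1 - 1 / 139) / d%:R =
    69 / 70 * n%:R / d%:R / (1 - 5 / 2 * m%:R^-1) :> R.
  by rewrite m350; field; rewrite gt_eqF.
apply: opnorm_le_form.
apply: (@weighted_form_net_bound _ _ _ v y [set z |
  exists2 k : net_index d (m * d),
   (net_weight k <= m * d)%N & z = net_point R m k]).
- by rewrite invr_gt0 ltr0n.
- by rewrite m350; lra.
- move=> x x1; have [k k1 [k2 k3]] := net_cover d0 m0 (leqnn (m * d)) x1.
  by exists (net_point R m k) => //; exists k.
move=> _ [k hk ->]; set z := net_point R m k => z1.
have [->|z0] := eqVneq z 0.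
  rewrite -(scale0r 0) weighted_formZl mul0r normr0 divr_ge0 // ?mulr_ge0 //.
set u := (enorm z)^-1 *: z.
have zE : z = enorm z *: u.
  by rewrite /u scalerA divff ?scale1r // enorm_eq0.
apply: (@le_trans _ _ `|weighted_form v y u u|).
  rewrite {1 2}zE weighted_formZl weighted_formZr mulrA -expr2 enorm_sqr normrM.
  by rewrite ler_piMl // ger0_norm ?dot_ge0.
(* The zero sum of [y] permits subtracting 1/(2d), which is t/d for t = 1/2. *)
have -> : weighted_form v y u u = \sum_j y j ord0 * (dot (v j) u ^+ 2 - (2 *
  d%:R)^-1).
  rewrite (eq_bigr (fun j => y j ord0 * (dot (v j) u * dot (v j) u) -
     y j ord0 * (2 * d%:R)^-1)); last by move=> j _; rewrite mulrBr expr2.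
  by rewrite sumrB -mulr_suml y0 mul0r subr0.
apply: (le_trans (ler_norm_sum _ _ _)).
apply: (@le_trans _ _ (\sum_j sphere_dev u (v j) / d%:R)); last first.
  by rewrite -mulr_suml ler_pM2r ?invr_gt0 //; exact: hv.
apply: ler_sum => j _; rewrite normrM.
apply: (@le_trans _ _ `|dot (v j) u ^+ 2 - (2 * d%:R)^-1|).
  by apply: ler_piMl => //; exact: le_trans (le_mx_norm _ _ _) y1.
rewrite ler_pdivlMr // /sphere_dev /sphere_sq -[X in _ * X](gtr0_norm dR)
  -normrM.
by rewrite le_eqVlt; apply/orP; left; apply/eqP; congr `| _ |; field;
  rewrite gt_eqF.
Qed.

Theorem theorem2p13 (R : realType) :
  exists C c lam0 : R,
    [/\ 0 < C, 0 < c, 0 < lam0 & lam0 <= 1] /\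
    forall (d n : nat), (0 < d)%N -> (0 < n)%N -> C * d%:R <= n%:R ->
    forall (dO : measure_display) (Omega : measurableType dO)
      (P : probability Omega R) (v : 'I_n -> {RV P >-> borel_cV R d}),
      mutually_independent v ->
      (forall j, uniform_on_sphere (distribution P (v j))) ->
      let E := [set w | exists2 lam : R, lam0 <= lam &
                  inf_expansion lam (matrix_of_columns (fun j => v j w))] in
      measurable E /\ ((1 - expR (- c * n%:R))%:E <= P E)%E.
Proof.
have [m m350] : exists m : nat, m%:R = 350 :> R by exists 350%N.
pose c : R := (140 ^+ 2 * 1024)^-1.
pose K : R := 2 ^+ m * 4.
have c0 : 0 < c.
  by rewrite invr_gt0; apply: mulr_gt0; rewrite ?exprn_gt0 ?ltr0n.
have K1 : 1 < K.
  have : 1 <= 2 ^+ m :> R by apply: exprn_ege1; lra.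
  by rewrite /K; lra.
have lnK0 : 0 < ln K by rewrite ln_gt0.
(* This [C] gives K^d <= exp(c n): the size of the net uses up half of the Chernoff exponent 2c, and
   the other half is the final rate. *)
exists (ln K / c), c, (1 / 139); split.
  by split; [exact: divr_gt0|exact: c0|lra|lra].
move=> d n d0 n0 Cdn dO Omega P v v_indep v_unif E.
have EE : E = [set w | inf_expansion (1 / 139) (matrix_of_columns (fun j =>
  v j w))].
  apply/seteqP; split=> [w [lam hl hE]|w hw]; last by exists (1 / 139).
  exact: inf_expansion_le hE.
have mE : measurable E by rewrite EE; exact: measurable_inf_expansion.
split=> //.
pose u (k : net_index d (m * d)) := (enorm (net_point R m k))^-1 *: net_point R
  m k.
have /choice[B hB] : forall k : net_index d (m * d), exists B : set Omega,
    [/\ measurable B, net_point R m k != 0 -> forall w, (forall j,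
      sphere (v j w)) ->
     69 / 70 * n%:R < \sum_j sphere_dev (u k) (v j w) -> B w &
     fine (P B) <= expR (- (2 * c * n%:R))].
  (* The origin has no direction to test, so its bad event is empty. *)
  move=> k; have [k0|k0] := eqVneq (net_point R m k) 0.
    by exists set0; split; rewrite ?k0 ?eqxx // measure0 expR_ge0.
  by have [B mB [hB PB]] := sphere_dev_chernoff v_indep v_unif d0 (dot_unit k0);
    exists B; split.
(* The vectors lie on the sphere only almost surely; these null events collect the exceptions. *)
pose N j : set Omega := v j @^-1` (~` sphere).
have mN j : measurable (N j).
  by apply: measurable_funPTI; apply: measurableC; exact: measurable_sphere.
have PN j : fine (P (N j)) = 0.
  have -> : P (N j) = distribution P (v j) (~` sphere) by [].
  rewrite probability_setC; last exact: measurable_sphere.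
  transitivity (fine (1 - 1 : \bar R)%E); last by rewrite subee.
  by congr (fine (1 - _)%E); case: (v_unif j).
have mB k : measurable (B k) by case: (hB k).
have [mU1 PU1] := union_bound P (fun k => (net_weight k <= m * d)%N) mB.
have [mU2 PU2] := union_bound P predT mN.
set U1 := \big[setU/set0]_(k | _) B k in mU1 PU1.
set U2 := \big[setU/set0]_(j | _) N j in mU2 PU2.
have sub : ~` E `<=` U1 `|` U2.
  move=> w; apply: contra_notP => /not_orP[nU1 nU2]; rewrite EE.
  have vS j : sphere (v j w).
    by apply: contrapT => h; apply: nU2; apply: (bigsetU_mem (j := j)).
  apply: (inf_expansion_from_net d0 m350) => [j|k hk k0]; first exact: sphereP.
  rewrite leNgt; apply/negP => h; apply: nU1; apply: (bigsetU_mem (j := k)) =>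
    //.
  by case: (hB k) => _ /(_ k0 w vS h).
have PE : fine (P (~` E)) <= expR (- c * n%:R).
  have h1 : fine (P (~` E)) <= fine (P U1) + fine (P U2).
    have mC := measurableC mE.
    rewrite -fineD ?fin_num_measure // fine_le ?fin_numD ?fin_num_measure //.
    apply: le_trans (measureU2 P mU1 mU2).
    by apply: le_measure; rewrite ?inE //; exact: measurableU.
  apply: (le_trans h1); rewrite -[leRHS]addr0; apply: lerD; last first.
    by apply: (le_trans PU2); rewrite big1.
  apply: (le_trans PU1).
  apply: (@le_trans _ _ (\sum_(k : net_index d (m * d) |
    (net_weight k <= m * d)%N)
     1 * expR (- (2 * c * n%:R)))).
    by apply: ler_sum => k _; rewrite mul1r; case: (hB k).
  rewrite -mulr_suml.
  apply: (le_trans (ler_wpM2r (expR_ge0 _) (card_net R d (m * d) (m * d)))).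
  have -> : 2 ^+ (m * d) * 4 ^+ d = expR (d%:R * ln K).
    by rewrite expRM_natl lnK ?exprMn ?exprM // posrE (lt_trans ltr01).
  rewrite -expRD ler_expR.
  have : d%:R * ln K <= c * n%:R.
    by move: Cdn; rewrite mulrAC ler_pdivrMr // mulrC (mulrC _ c).
  lra.
rewrite -[E]setCK probability_setC; last exact: measurableC.
rewrite -[P (~` E)]fineK ?fin_num_measure //; last exact: measurableC.
by rewrite -EFinB lee_fin lerD2l lerN2.
Qed.
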